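(* Let $X$ be a path connected, locally path connected topological space with base point $x_0$, let $H\le\pi_1(X,x_0)$, and suppose $X$ is $H$-SLT at $x_0$. Then $H$ is an open subgroup of $\pi_1^{wh}(X,x_0)$ if and only if $H$ is an open subgroup of $\pi_1^{qtop}(X,x_0)$.
   Context: $\ast$ denotes concatenation of paths and $\alpha^{-1}$ the reverse path. For paths $\alpha,\beta$ in $X$ starting at $x_0$, write $[\alpha]_H=[\beta]_H$ iff $\alpha(1)=\beta(1)$ and $[\alpha\ast\beta^{-1}]\in H$. $\pi_1^{wh}(X,x_0)$ is the fundamental group with the whisker topology, with basis the sets $([\alpha],W)=\{[\alpha\ast\beta]:\beta\text{ a loop in }W\text{ based at }x_0\}$, where $[\alpha]\in\pi_1(X,x_0)$ and $W$ is an open neighborhood of $x_0$. $\pi_1^{qtop}(X,x_0)$ is the fundamental group with the quotient topology from the space of loops based at $x_0$ with the compact-open topology. $X$ is $H$-SLT at $x_0$ if for every path $\alpha$ in $X$ beginning at $x_0$ and every open set $U\ni x_0$ there is an open set $V\ni\alpha(1)$ such that for every loop $\beta$ in $V$ based at $\alpha(1)$ there is a loop $\gamma$ in $U$ based at $x_0$ with $[\alpha\ast\beta\ast\alpha^{-1}]_H=[\gamma]_H$. *)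

(* Defs.v *)
From HB Require Import structures.
From mathcomp Require Import all_boot all_order all_algebra generic_quotient.
From mathcomp Require Import lra.
From mathcomp Require Import mathcomp_extra boolp classical_sets functions.
From mathcomp Require Import set_interval reals topology normedtype homotopy.

Set Implicit Arguments.
Unset Strict Implicit.
Unset Printing Implicit Defensive.

Import Order.TTheory GRing.Theory Num.Theory.
Import numFieldNormedType.Exports.

Local Open Scope classical_set_scope.
Local Open Scope ring_scope.
Local Open Scope quotient_scope.

(* The unit interval as a bipointed space, so that the paths of a space are the
   elements of the library's [pathType]. *)
Section unit_interval.
Variable R : realType.

Definition unit_interval : Type := `[0%R, 1%R : R]%classic.

HB.instance Definition _ :=
  Topological.copy unit_interval (`[0%R, 1%R : R]%classic : Type).

Definition uival (t : unit_interval) : R := set_val t.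

Lemma uival_ge0 (t : unit_interval) : 0 <= uival t.
Proof. by have := set_valP t; rewrite /= in_itv /= => /andP[]. Qed.

Lemma uival_le1 (t : unit_interval) : uival t <= 1.
Proof. by have := set_valP t; rewrite /= in_itv /= => /andP[]. Qed.

Lemma uival_inj : injective uival.
Proof. by move=> s t; exact: val_inj. Qed.

Lemma uival_continuous : continuous uival.
Proof. exact: initial_continuous. Qed.

Lemma uiproj_subproof (r : R) :
  Num.max 0 (Num.min 1 r) \in `[0%R, 1%R : R]%classic.
Proof.
rewrite inE /= in_itv /= le_max lexx /= ge_max ler01 /=.
by rewrite ge_min lexx.
Qed.

(* the nearest-point retraction of the line onto the unit interval *)
Definition uiproj (r : R) : unit_interval :=
  exist _ (Num.max 0 (Num.min 1 r)) (uiproj_subproof r).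

Lemma uiprojE (r : R) : uival (uiproj r) = Num.max 0 (Num.min 1 r).
Proof. by []. Qed.

Lemma uivalK : cancel uival uiproj.
Proof.
move=> t; apply: uival_inj; rewrite uiprojE.
by rewrite (min_idPr (uival_le1 t)) (max_idPr (uival_ge0 t)).
Qed.

Lemma uiprojK (r : R) : 0 <= r <= 1 -> uival (uiproj r) = r.
Proof.
by case/andP => r0 r1; rewrite uiprojE (min_idPr r1) (max_idPr r0).
Qed.

Lemma uiproj_continuous : continuous uiproj.
Proof.
apply: continuous_comp_initial => r.
apply: (@continuous_max _ _ (cst 0) (fun r : R => Num.min 1 r)).
  exact: cst_continuous.
apply: (@continuous_min _ _ (cst 1) id); first exact: cst_continuous.
by move=> ?.
Qed.

Lemma uiproj01 : uiproj 0 != uiproj 1.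
Proof.
apply/eqP => /(congr1 uival); rewrite !uiprojK ?lexx ?ler01 //.
by apply/eqP; rewrite eq_sym oner_eq0.
Qed.

HB.instance Definition _ :=
  isBiPointed.Build unit_interval uiproj01.

End unit_interval.

Lemma continuous_paste (R : realType) (T X : topologicalType) (h : T -> R)
    (c : R) (f g : T -> X) :
  continuous h -> continuous f -> continuous g ->
  (forall t, h t = c -> f t = g t) ->
  continuous (fun t => if h t <= c then f t else g t).
Proof.
move=> ch cf cg fg t U /=.
have [htc|cht|htc] := ltgtP (h t) c => Ut; near_simpl; last first.
  have Ugt : nbhs (g t) U by rewrite -fg.
  near=> s => /=.
  by case: ifP => _; near: s; [exact: cf|exact: cg].
all: near=> s => /=.
- have /lt_geF -> : c < h s by near: s; exact: (ch t _ (lt_nbhsr cht)).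
  by near: s; exact: cg.
- have /ltW -> : h s < c by near: s; exact: (ch t _ (lt_nbhsl htc)).
  by near: s; exact: cf.
Unshelve. all: by end_near. Qed.

Section real_valued.
Variables (R : realType) (T : topologicalType) (u v : T -> R).
Hypotheses (cu : continuous u) (cv : continuous v).

Lemma cont_add : continuous (fun t => u t + v t).
Proof. by move=> t; exact: (continuousD (@cu t) (@cv t)). Qed.

Lemma cont_sub : continuous (fun t => u t - v t).
Proof. by move=> t; exact: (continuousB (@cu t) (@cv t)). Qed.

Lemma cont_mul : continuous (fun t => u t * v t).
Proof. by move=> t; exact: (continuousM (@cu t) (@cv t)). Qed.

Lemma cont_min : continuous (fun t => Num.min (u t) (v t)).
Proof. by move=> t; exact: (continuous_min (@cu t) (@cv t)). Qed.

Lemma cont_max : continuous (fun t => Num.max (u t) (v t)).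
Proof. by move=> t; exact: (continuous_max (@cu t) (@cv t)). Qed.

End real_valued.

Section paths.
Variables (R : realType) (X : topologicalType).
Local Notation I := (unit_interval R).
Implicit Types x y z : X.

Lemma uiproj_le0 (r : R) : r <= 0 -> uiproj r = zero.
Proof.
move=> r0; apply: uival_inj; rewrite !uiprojE.
by rewrite (min_idPr _) ?(le_trans r0) // (max_idPl r0) (min_idPr ler01) maxxx.
Qed.

Lemma uiproj_ge1 (r : R) : 1 <= r -> uiproj r = one.
Proof.
move=> r1; apply: uival_inj; rewrite !uiprojE.
by rewrite (min_idPl r1) minxx.
Qed.

Lemma uival_zero : uival (zero : I) = 0.
Proof. by rewrite uiprojK // lexx ler01. Qed.

Lemma uival_one : uival (one : I) = 1.
Proof. by rewrite uiprojK // lexx ler01. Qed.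

Lemma comp_uiproj_continuous (T : topologicalType) (f : I -> X) (u : T -> R) :
  continuous f -> continuous u -> continuous (fun t => f (uiproj (u t))).
Proof.
move=> cf cu t.
apply: (@continuous_comp _ _ _ (fun t => uiproj (u t)) f); last exact: cf.
apply: (@continuous_comp _ _ _ u (@uiproj R)); first exact: cu.
exact: uiproj_continuous.
Qed.

Definition concat_fun (a b : I -> X) (t : I) : X :=
  if uival t <= 2^-1 then a (uiproj (2 * uival t))
  else b (uiproj (2 * uival t - 1)).

Definition reverse_fun (a : I -> X) (t : I) : X := a (uiproj (1 - uival t)).

Section concat.
Variables (x y z : X) (a : {path I from x to y}) (b : {path I from y to z}).

Lemma concat_continuous : continuous (concat_fun a b).
Proof.
apply: continuous_paste.
- exact: uival_continuous.
- apply: comp_uiproj_continuous; first exact: cts_fun.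
  by apply: cont_mul; [exact: cst_continuous|exact: uival_continuous].
- apply: comp_uiproj_continuous; first exact: cts_fun.
  apply: cont_sub; last exact: cst_continuous.
  by apply: cont_mul; [exact: cst_continuous|exact: uival_continuous].
- move=> t ->; rewrite mulfV ?pnatr_eq0// subrr.
  by rewrite path_one path_zero.
Qed.

Lemma concat_zero : concat_fun a b zero = x.
Proof.
by rewrite /concat_fun uival_zero invr_ge0 ler0n mulr0 path_zero.
Qed.

Lemma concat_one : concat_fun a b one = z.
Proof.
rewrite /concat_fun uival_one ifF; last by apply/negbTE; lra.
by rewrite uiproj_ge1 ?path_one//; lra.
Qed.

HB.instance Definition _ :=
  isContinuous.Build _ _ (concat_fun a b) concat_continuous.
HB.instance Definition _ :=
  isPath.Build I X x z (concat_fun a b) concat_zero concat_one.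

Definition path_concat : {path I from x to z} := concat_fun a b.

Lemma reverse_continuous : continuous (reverse_fun a).
Proof.
apply: comp_uiproj_continuous; first exact: cts_fun.
by apply: cont_sub; [exact: cst_continuous|exact: uival_continuous].
Qed.

Lemma reverse_zero : reverse_fun a zero = y.
Proof. by rewrite /reverse_fun uival_zero subr0 path_one. Qed.

Lemma reverse_one : reverse_fun a one = x.
Proof. by rewrite /reverse_fun uival_one subrr path_zero. Qed.

HB.instance Definition _ :=
  isContinuous.Build _ _ (reverse_fun a) reverse_continuous.
HB.instance Definition _ :=
  isPath.Build I X y x (reverse_fun a) reverse_zero reverse_one.

Definition path_reverse : {path I from y to x} := reverse_fun a.

End concat.

Definition path_const x : {path I from x to x} := (cst x : I -> X).

(* homotopy relative to the endpoints; the second coordinate is the time *)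
Definition path_homotopic x y (a b : {path I from x to y}) : Prop :=
  exists F : I * I -> X,
    [/\ continuous F,
        forall t, F (t, zero) = a t,
        forall t, F (t, one) = b t,
        forall s, F (zero, s) = x &
        forall s, F (one, s) = y].


Lemma cont_pair (S T U V : topologicalType) (F : U * V -> T)
    (u : S -> U) (v : S -> V) :
  continuous F -> continuous u -> continuous v ->
  continuous (fun t => F (u t, v t)).
Proof.
move=> cF cu cv t; apply: (@continuous_comp _ _ _ (fun t => (u t, v t)) F).
  by apply: cvg_pair; [exact: cu|exact: cv].
exact: cF.
Qed.

Lemma uival_fst_continuous : continuous (fun p : I * I => uival p.1).
Proof.
move=> p; apply: (@continuous_comp _ _ _ fst (@uival R)); first exact: cvg_fst.
exact: uival_continuous.
Qed.

Lemma uival_snd_continuous : continuous (fun p : I * I => uival p.2).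
Proof.
move=> p; apply: (@continuous_comp _ _ _ snd (@uival R)); first exact: cvg_snd.
exact: uival_continuous.
Qed.

Lemma uiproj_comp_continuous (T : topologicalType) (u : T -> R) :
  continuous u -> continuous (fun t => uiproj (u t)).
Proof.
move=> cu t; apply: (@continuous_comp _ _ _ u (@uiproj R)); first exact: cu.
exact: uiproj_continuous.
Qed.

Lemma path_homotopic_reparam (x y x' y' : X) (f : {path I from x to y})
    (g h : {path I from x' to y'}) (u v : I -> R) :
  continuous u -> continuous v ->
  u zero = v zero -> u one = v one ->
  (forall t, g t = f (uiproj (u t))) -> (forall t, h t = f (uiproj (v t))) ->
  path_homotopic g h.
Proof.
move=> cu cv uv0 uv1 gE hE.
exists (fun p => f (uiproj (u p.1 + uival p.2 * (v p.1 - u p.1)))); split.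
- apply: comp_uiproj_continuous; first exact: cts_fun.
  have cu1 : continuous (fun p : I * I => u p.1).
    move=> p; apply: (@continuous_comp _ _ _ fst u); first exact: cvg_fst.
    exact: cu.
  have cv1 : continuous (fun p : I * I => v p.1).
    move=> p; apply: (@continuous_comp _ _ _ fst v); first exact: cvg_fst.
    exact: cv.
  apply: cont_add => //; apply: cont_mul; first exact: uival_snd_continuous.
  exact: cont_sub.
- by move=> t /=; rewrite uival_zero mul0r addr0 gE.
- by move=> t /=; rewrite uival_one mul1r addrC subrK hE.
- by move=> s /=; rewrite uv0 subrr mulr0 addr0 -hE path_zero.
- by move=> s /=; rewrite uv1 subrr mulr0 addr0 -hE path_one.
Qed.

Lemma path_homotopic_refl x y (a : {path I from x to y}) : path_homotopic a a.
Proof.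
exists (fun p => a p.1); split=> // [p|s|s]; last 2 first.
- by rewrite path_zero.
- by rewrite path_one.
by apply: (@continuous_comp _ _ _ fst a); [exact: cvg_fst|exact: cts_fun].
Qed.

Lemma path_homotopic_sym x y (a b : {path I from x to y}) :
  path_homotopic a b -> path_homotopic b a.
Proof.
move=> [F [cF F0 F1 Fx Fy]].
exists (fun p => F (p.1, uiproj (1 - uival p.2))); split=> [|t|t|s|s] /=.
- apply: cont_pair => //; first by move=> p; exact: cvg_fst.
  apply: uiproj_comp_continuous; apply: cont_sub; first exact: cst_continuous.
  exact: uival_snd_continuous.
- by rewrite uival_zero subr0 -F1.
- by rewrite uival_one subrr -F0.
- exact: Fx.
- exact: Fy.
Qed.

Lemma path_homotopic_trans x y (a b c : {path I from x to y}) :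
  path_homotopic a b -> path_homotopic b c -> path_homotopic a c.
Proof.
move=> [F [cF F0 F1 Fx Fy]] [G [cG G0 G1 Gx Gy]].
exists (fun p => if uival p.2 <= 2^-1 then F (p.1, uiproj (2 * uival p.2))
                 else G (p.1, uiproj (2 * uival p.2 - 1))).
have c2 : continuous (fun p : I * I => 2 * uival p.2).
  by apply: cont_mul; [exact: cst_continuous|exact: uival_snd_continuous].
split=> [|t|t|s|s] /=.
- apply: continuous_paste.
  + exact: uival_snd_continuous.
  + apply: cont_pair => //; first by move=> p; exact: cvg_fst.
    exact: uiproj_comp_continuous.
  + apply: cont_pair => //; first by move=> p; exact: cvg_fst.
    apply: uiproj_comp_continuous; apply: cont_sub => //.
    exact: cst_continuous.
  + by move=> p ->; rewrite mulfV ?pnatr_eq0// subrr F1 G0.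
- by rewrite uival_zero invr_ge0 ler0n mulr0 F0.
- rewrite uival_one ifF; last by apply/negbTE; lra.
  by rewrite uiproj_ge1 ?G1//; lra.
- by case: ifP => _; [exact: Fx|exact: Gx].
- by case: ifP => _; [exact: Fy|exact: Gy].
Qed.

Lemma path_homotopic_concat x y z (a a' : {path I from x to y})
    (b b' : {path I from y to z}) :
  path_homotopic a a' -> path_homotopic b b' ->
  path_homotopic (path_concat a b) (path_concat a' b').
Proof.
move=> [F [cF F0 F1 Fx Fy]] [G [cG G0 G1 Gx Gy]].
exists (fun p => if uival p.1 <= 2^-1 then F (uiproj (2 * uival p.1), p.2)
                 else G (uiproj (2 * uival p.1 - 1), p.2)).
have c2 : continuous (fun p : I * I => 2 * uival p.1).
  by apply: cont_mul; [exact: cst_continuous|exact: uival_fst_continuous].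
split=> [|t|t|s|s] /=.
- apply: continuous_paste.
  + exact: uival_fst_continuous.
  + apply: cont_pair => //; last by move=> p; exact: cvg_snd.
    exact: uiproj_comp_continuous.
  + apply: cont_pair => //; last by move=> p; exact: cvg_snd.
    apply: uiproj_comp_continuous; apply: cont_sub => //.
    exact: cst_continuous.
  + by move=> p ->; rewrite mulfV ?pnatr_eq0// subrr Fy Gx.
- by rewrite F0 G0.
- by rewrite F1 G1.
- by rewrite uival_zero invr_ge0 ler0n mulr0 Fx.
- rewrite uival_one ifF; last by apply/negbTE; lra.
  by rewrite uiproj_ge1 ?Gy//; lra.
Qed.

Lemma path_homotopic_reverse x y (a a' : {path I from x to y}) :
  path_homotopic a a' -> path_homotopic (path_reverse a) (path_reverse a').
Proof.
move=> [F [cF F0 F1 Fx Fy]].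
exists (fun p => F (uiproj (1 - uival p.1), p.2)); split=> [|t|t|s|s] /=.
- apply: cont_pair => //; last by move=> p; exact: cvg_snd.
  apply: uiproj_comp_continuous; apply: cont_sub; first exact: cst_continuous.
  exact: uival_fst_continuous.
- exact: F0.
- exact: F1.
- by rewrite uival_zero subr0 Fy.
- by rewrite uival_one subrr Fx.
Qed.

Lemma assoc_paramP (r : R) :
  let v := Num.min (2 * r) (Num.min (r + 4^-1) (2^-1 * (r + 1))) in
  [\/ r <= 4^-1 /\ v = 2 * r,
      4^-1 < r /\ r <= 2^-1 /\ v = r + 4^-1 |
      2^-1 < r /\ v = 2^-1 * (r + 1)].
Proof.
have [r4|r4] := lerP r 4^-1.
  by apply: Or31; split=> //; rewrite min_l ?le_min//; apply/andP; lra.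
have [r2|r2] := lerP r 2^-1.
  apply: Or32; do !split=> //; rewrite (min_l (x := r + 4^-1)); last lra.
  by rewrite min_r //; lra.
apply: Or33; split=> //; rewrite (min_r (x := r + 4^-1)); last lra.
by rewrite min_r //; lra.
Qed.

Lemma concatA x y z w (a : {path I from x to y}) (b : {path I from y to z})
    (c : {path I from z to w}) :
  path_homotopic (path_concat a (path_concat b c))
                 (path_concat (path_concat a b) c).
Proof.
pose v (t : I) : R := Num.min (2 * uival t)
  (Num.min (uival t + 4^-1) (2^-1 * (uival t + 1))).
apply: (@path_homotopic_reparam _ _ _ _ (path_concat a (path_concat b c))
  _ _ (@uival R) v).
- exact: uival_continuous.
- apply: cont_min; last apply: cont_min.
  + by apply: cont_mul; [exact: cst_continuous|exact: uival_continuous].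
  + by apply: cont_add; [exact: uival_continuous|exact: cst_continuous].
  + apply: cont_mul; first exact: cst_continuous.
    by apply: cont_add; [exact: uival_continuous|exact: cst_continuous].
- by rewrite /v uival_zero; case: (assoc_paramP 0) => /= ?; lra.
- by rewrite /v uival_one; case: (assoc_paramP 1) => /= ?; lra.
- by move=> t; rewrite uivalK.
- move=> t; have := uival_ge0 t; have := uival_le1 t => t1 t0.
  have vb : 0 <= v t <= 1 by rewrite /v; case: (assoc_paramP (uival t)) => /= ?; lra.
  rewrite /path_concat /= /concat_fun (uiprojK vb).
  have [t2|t2] := lerP (uival t) 2^-1.
    have t2b : 0 <= 2 * uival t <= 1 by lra.
    rewrite (uiprojK t2b).
    have [t4|t4] := lerP (2 * uival t) 2^-1.
      have -> : v t = 2 * uival t by rewrite /v; case: (assoc_paramP (uival t)) => /= ?; lra.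
      by rewrite t4.
    have -> : v t = uival t + 4^-1 by rewrite /v; case: (assoc_paramP (uival t)) => /= ?; lra.
    have -> : (uival t + 4^-1 <= 2^-1) = false by apply/negbTE; lra.
    have -> : 2 * (uival t + 4^-1) - 1 = 2 * uival t - 2^-1 by lra.
    rewrite uiprojK; last by lra.
    have -> : (2 * uival t - 2^-1 <= 2^-1) by lra.
    by congr (b (uiproj _)); lra.
  have -> : v t = 2^-1 * (uival t + 1).
    by rewrite /v; case: (assoc_paramP (uival t)) => /= ?; lra.
  have -> : (2^-1 * (uival t + 1) <= 2^-1) = false by apply/negbTE; lra.
  have -> : 2 * (2^-1 * (uival t + 1)) - 1 = uival t by lra.
  rewrite uivalK.
  by have -> : (uival t <= 2^-1) = false by apply/negbTE; lra.
Qed.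

Lemma concat1p x y (a : {path I from x to y}) :
  path_homotopic (path_concat (path_const x) a) a.
Proof.
apply: (@path_homotopic_reparam _ _ _ _ a _ _
  (fun t : I => Num.max 0 (2 * uival t - 1)) (@uival R)).
- apply: cont_max; first exact: cst_continuous.
  apply: cont_sub; last exact: cst_continuous.
  by apply: cont_mul; [exact: cst_continuous|exact: uival_continuous].
- exact: uival_continuous.
- by rewrite uival_zero maxElt; case: ifP => ?; lra.
- by rewrite uival_one maxElt; case: ifP => ?; lra.
- move=> t; rewrite /path_concat /= /concat_fun /=.
  have [t2|t2] := lerP (uival t) 2^-1.
    by rewrite (max_idPl _) ?(uiproj_le0 (lexx 0)) ?path_zero //; lra.
  by rewrite (max_idPr _) //; lra.
- by move=> t; rewrite uivalK.
Qed.

Lemma concatp1 x y (a : {path I from x to y}) :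
  path_homotopic (path_concat a (path_const y)) a.
Proof.
apply: (@path_homotopic_reparam _ _ _ _ a _ _
  (fun t : I => Num.min 1 (2 * uival t)) (@uival R)).
- apply: cont_min; first exact: cst_continuous.
  by apply: cont_mul; [exact: cst_continuous|exact: uival_continuous].
- exact: uival_continuous.
- by rewrite uival_zero minElt; case: ifP => ?; lra.
- by rewrite uival_one minElt; case: ifP => ?; lra.
- move=> t; rewrite /path_concat /= /concat_fun /=.
  have [t2|t2] := lerP (uival t) 2^-1.
    by rewrite (min_idPr _) //; lra.
  by rewrite (min_idPl _) ?(uiproj_ge1 (lexx 1)) ?path_one //; lra.
- by move=> t; rewrite uivalK.
Qed.

Lemma concatpV x y (a : {path I from x to y}) :
  path_homotopic (path_concat a (path_reverse a)) (path_const x).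
Proof.
apply: (@path_homotopic_reparam _ _ _ _ a _ _
  (fun t : I => Num.min (2 * uival t) (2 - 2 * uival t)) (cst 0)).
- apply: cont_min; last apply: cont_sub; try exact: cst_continuous.
  + by apply: cont_mul; [exact: cst_continuous|exact: uival_continuous].
  + by apply: cont_mul; [exact: cst_continuous|exact: uival_continuous].
- exact: cst_continuous.
- by rewrite uival_zero minElt; case: ltP => ?; rewrite /cst; lra.
- by rewrite uival_one minElt; case: ltP => ?; rewrite /cst; lra.
- move=> t; rewrite /path_concat /= /concat_fun.
  have := uival_ge0 t; have := uival_le1 t => t1 t0.
  have [t2|t2] := lerP (uival t) 2^-1.
    by rewrite (min_idPl _) //; lra.
  rewrite (min_idPr _) /path_reverse /= /reverse_fun; last by lra.
  rewrite uiprojK; last by lra.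
  by congr (a (uiproj _)); lra.
- by move=> t; rewrite /= uiproj_le0 ?path_zero.
Qed.

Lemma reverseK x y (a : {path I from x to y}) :
  path_reverse (path_reverse a) = a.
Proof.
apply/path_eqP => t; rewrite /path_reverse /= /reverse_fun.
have := uival_ge0 t; have := uival_le1 t => t1 t0.
by rewrite uiprojK; [rewrite subKr uivalK|lra].
Qed.

Lemma concatVp x y (a : {path I from x to y}) :
  path_homotopic (path_concat (path_reverse a) a) (path_const y).
Proof. by rewrite -{2}(reverseK a); exact: concatpV. Qed.


End paths.

Section fundamental_group.
Variables (R : realType) (X : topologicalType) (x0 : X).
Local Notation I := (unit_interval R).
Local Notation loop := {path I from x0 to x0}.

Lemma loop_homotopic_refl : reflexive (fun a b : loop => `[< path_homotopic a b >]).
Proof. by move=> a; apply/asboolP; exact: path_homotopic_refl. Qed.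

Lemma loop_homotopic_sym : symmetric (fun a b : loop => `[< path_homotopic a b >]).
Proof.
by move=> a b; apply/asboolP/asboolP; exact: path_homotopic_sym.
Qed.

Lemma loop_homotopic_trans :
  transitive (fun a b : loop => `[< path_homotopic a b >]).
Proof.
move=> b a c /asboolP ab /asboolP bc; apply/asboolP.
exact: path_homotopic_trans bc.
Qed.

Definition loop_homotopic : equiv_rel loop :=
  EquivRel _ loop_homotopic_refl loop_homotopic_sym loop_homotopic_trans.

Definition pi1 : Type := {eq_quot loop_homotopic}.

HB.instance Definition _ := Choice.on pi1.
HB.instance Definition _ := Quotient.on pi1.
HB.instance Definition _ := EqQuotient.on pi1.

Definition pi1_class (a : loop) : pi1 := \pi_pi1 a.

Lemma pi1_classP (a b : loop) :
  pi1_class a = pi1_class b <-> path_homotopic a b.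
Proof.
by split=> [/eqmodP/asboolP//|ab]; apply/eqmodP/asboolP.
Qed.

Lemma pi1_ind (P : pi1 -> Prop) :
  (forall a, P (pi1_class a)) -> forall c, P c.
Proof. by move=> Pa c; rewrite -[c]reprK; exact: Pa. Qed.

Definition pi1_mul (c d : pi1) : pi1 :=
  pi1_class (path_concat (repr c) (repr d)).

Definition pi1_inv (c : pi1) : pi1 := pi1_class (path_reverse (repr c)).

Lemma repr_class (a : loop) : path_homotopic (repr (pi1_class a)) a.
Proof. by apply/pi1_classP; exact: reprK. Qed.

Lemma pi1_mulE (a b : loop) :
  pi1_mul (pi1_class a) (pi1_class b) = pi1_class (path_concat a b).
Proof. by apply/pi1_classP; apply: path_homotopic_concat; exact: repr_class. Qed.

Lemma pi1_invE (a : loop) : pi1_inv (pi1_class a) = pi1_class (path_reverse a).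
Proof. by apply/pi1_classP; apply: path_homotopic_reverse; exact: repr_class. Qed.

Lemma pi1_mulA : associative pi1_mul.
Proof.
elim/pi1_ind => a; elim/pi1_ind => b; elim/pi1_ind => c.
by rewrite !pi1_mulE; apply/pi1_classP; exact: concatA.
Qed.

Lemma pi1_mul1 : left_id (pi1_class (path_const R x0)) pi1_mul.
Proof.
by elim/pi1_ind => a; rewrite pi1_mulE; apply/pi1_classP; exact: concat1p.
Qed.

Lemma pi1_1mul : right_id (pi1_class (path_const R x0)) pi1_mul.
Proof.
by elim/pi1_ind => a; rewrite pi1_mulE; apply/pi1_classP; exact: concatp1.
Qed.

Lemma pi1_mulV :
  left_inverse (pi1_class (path_const R x0)) pi1_inv pi1_mul.
Proof.
elim/pi1_ind => a; rewrite pi1_invE pi1_mulE.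
by apply/pi1_classP; exact: concatVp.
Qed.

Lemma pi1_Vmul :
  right_inverse (pi1_class (path_const R x0)) pi1_inv pi1_mul.
Proof.
elim/pi1_ind => a; rewrite pi1_invE pi1_mulE.
by apply/pi1_classP; exact: concatpV.
Qed.

HB.instance Definition _ :=
  isGroup.Build pi1 pi1_mulA pi1_mul1 pi1_1mul pi1_mulV pi1_Vmul.

HB.instance Definition _ := isPointed.Build pi1 (1 : pi1)%g.

Lemma pi1_classM (a b : loop) :
  pi1_class (path_concat a b) = (pi1_class a * pi1_class b)%g.
Proof. by rewrite -pi1_mulE. Qed.

Lemma pi1_classV (a : loop) :
  pi1_class (path_reverse a) = (pi1_class a)^-1%g.
Proof. by rewrite -pi1_invE. Qed.

Lemma pi1_class1 : pi1_class (path_const R x0) = 1%g.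
Proof. by []. Qed.

End fundamental_group.

Section fundamental_group_topologies.
Variables (R : realType) (X : topologicalType) (x0 : X).
Local Notation I := (unit_interval R).
Local Notation loop := {path I from x0 to x0}.
Local Notation pi1 := (pi1 R x0).

(* [([a], W)], written with [c = [a]]: [[a * b] = [a] * [b]] by [pi1_classM] *)
Definition whisker_set (c : pi1) (W : set X) : set pi1 :=
  [set (c * pi1_class b)%g | b in [set b : loop | range b `<=` W]].

Lemma range_concat x y z (a : {path I from x to y}) (b : {path I from y to z})
    (W : set X) :
  range a `<=` W -> range b `<=` W -> range (path_concat a b) `<=` W.
Proof.
move=> aW bW _ [t _ <-]; rewrite /path_concat /= /concat_fun.
by case: ifP => _; [apply: aW|apply: bW].
Qed.

Lemma whisker_cover :
  \bigcup_(i in [set i : pi1 * set X | open i.2 /\ i.2 x0])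
    whisker_set i.1 i.2 = setT.
Proof.
rewrite -subTset => c _; exists (c, setT); first by split; first exact: openT.
by exists (path_const R x0); rewrite // pi1_class1 mulg1.
Qed.

Lemma whisker_join (i j : pi1 * set X) (c : pi1) :
  [set i : pi1 * set X | open i.2 /\ i.2 x0] i ->
  [set i : pi1 * set X | open i.2 /\ i.2 x0] j ->
  whisker_set i.1 i.2 c -> whisker_set j.1 j.2 c ->
  exists k, [/\ [set i : pi1 * set X | open i.2 /\ i.2 x0] k,
    whisker_set k.1 k.2 c &
    whisker_set k.1 k.2 `<=` whisker_set i.1 i.2 `&` whisker_set j.1 j.2].
Proof.
case: i j => [ci W] [cj V] [/= oW Wx0] [/= oV Vx0] [a aW ca] [b bV cb].
exists (c, W `&` V); split=> /=.
- by split=> //; exact: openI.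
- exists (path_const R x0); last by rewrite pi1_class1 mulg1.
  by move=> _ [t _ <-].
- move=> _ [d dWV <-]; split.
  + exists (path_concat a d); last by rewrite pi1_classM mulgA ca.
    by apply: range_concat => // u /dWV[].
  + exists (path_concat b d); last by rewrite pi1_classM mulgA cb.
    by apply: range_concat => // u /dWV[].
Qed.

Definition pi1_wh : Type := pi1.

HB.instance Definition _ := Choice.on pi1_wh.
HB.instance Definition _ :=
  isBaseTopological.Build pi1_wh whisker_cover whisker_join.

(* The type of loops carries the subspace topology of the compact-open
   topology. *)
Definition pi1_qtop : Type := quotient_topology pi1.

HB.instance Definition _ := Topological.on pi1_qtop.

End fundamental_group_topologies.

Section path_conditions.
Variables (R : realType) (X : topologicalType).
Local Notation I := (unit_interval R).

Definition path_connected (A : set X) : Prop :=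
  forall x y, A x -> A y ->
    exists a : {path I from x to y}, range a `<=` A.

Definition locally_path_connected : Prop :=
  forall (x : X) (U : set X), nbhs x U ->
    exists V, [/\ open V, V x, V `<=` U & path_connected V].

End path_conditions.
Arguments locally_path_connected : clear implicits.

Section small_loop_transfer.
Variables (R : realType) (X : topologicalType) (x0 : X).
Local Notation I := (unit_interval R).

Definition is_subgroup (H : set (pi1 R x0)) : Prop := group_closed [in H].

Definition open_subgroup_wh (H : set (pi1 R x0)) : Prop :=
  is_subgroup H /\ open (H : set (pi1_wh R x0)).

Definition open_subgroup_qtop (H : set (pi1 R x0)) : Prop :=
  is_subgroup H /\ open (H : set (pi1_qtop R x0)).

(* The common endpoint of the two paths is part of their types. *)
Definition path_eq_mod (H : set (pi1 R x0)) (x : X)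
    (a b : {path I from x0 to x}) : Prop :=
  H (pi1_class (path_concat a (path_reverse b))).

Definition SLT_at (H : set (pi1 R x0)) : Prop :=
  forall (x : X) (a : {path I from x0 to x}) (U : set X), open U -> U x0 ->
    exists V : set X, [/\ open V, V x &
      forall b : {path I from x to x}, range b `<=` V ->
        exists2 c : {path I from x0 to x0}, range c `<=` U &
          path_eq_mod H (path_concat (path_concat a b) (path_reverse a)) c].

End small_loop_transfer.

(* Main.v *)
Require Import Defs.
From Corelib Require Import -(notations) RelationClasses Morphisms.
From mathcomp Require Import all_boot all_order all_algebra.
From mathcomp Require Import lra.
From mathcomp Require Import boolp classical_sets functions.
From mathcomp Require Import reals topology normedtype homotopy.

Set Implicit Arguments.
Unset Strict Implicit.
Unset Printing Implicit Defensive.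

Import Order.TTheory GRing.Theory Num.Theory.
Import numFieldNormedType.Exports.

Local Open Scope classical_set_scope.

(** Why the theorem is true.

    From the quotient topology to the whisker topology: a compact-open
    neighborhood of the constant loop contains every loop that stays in some
    neighborhood W of the base point ([nbhs_path_const]), so if H is open for
    the quotient topology then H contains the classes of all loops in such a W;
    for a subgroup this is exactly openness in the whisker topology
    ([open_whP]).

    The converse is where small loop transfer enters. Let H contain the classes
    of all loops in a neighborhood U of x0. Transferring small loops into U
    along a path a from x0 shows that near the endpoint of a there is no
    holonomy modulo H: for some neighborhood V of that endpoint, extending a by
    two paths in V with a common end gives paths that are equal modulo H
    ([SLT_paths_agree]). Fix now a loop a with class in H, and
    compare a with a loop a' near a. Say that a' tracks a up to time t if
    a' restricted to [0, t] is, modulo H, the restriction of a followed by a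
    short path from a(t) to a'(t) ([tracked]). This holds at time 0. If it holds
    at one time of a short interval it holds at every other time of it, because
    the two ways of going from a(s) to a'(t') (first along a and then across, or
    first across and then along a') both lie in a set V as above
    ([tracked_locally_stable]); local path connectedness provides the short path
    across. By connectedness of the unit interval it holds at time 1, where the
    short path is a loop in U, so [a'] lies in H together with [a]
    ([open_wh_qtop]). *)

(** * Connectedness *)

(** A property that propagates both ways between nearby points defines a set
    that is open and closed. *)
Lemma connected_locally_stable (T : topologicalType) (P : set T) :
  connected [set: T] -> P !=set0 ->
  (forall s : T, exists2 K : set T, nbhs s K &
    forall t t', K t -> K t' -> P t -> P t') ->
  forall t, P t.
Proof.
move=> Tconn P0 locP t; suff -> : P = setT by [].
apply: Tconn => //; exists P; rewrite ?setTI//.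
- rewrite openE => s Ps; have [K sK PK] := locP s.
  by apply: filterS (sK) => u Ku; exact: (PK s u (nbhs_singleton sK) Ku Ps).
- move=> s sP; have [K sK PK] := locP s.
  by have [u [Pu Ku]] := sP K sK; exact: (PK u s Ku (nbhs_singleton sK) Pu).
Qed.

(** * Calculus of homotopy classes of paths *)

#[local] Hint Resolve path_homotopic_refl : core.

Section homotopy_algebra.
Variables (R : realType) (X : topologicalType).
Local Notation I := (unit_interval R).

#[export] Instance path_homotopic_equivalence (x y : X) :
  Equivalence (@path_homotopic R X x y).
Proof.
split; [exact: path_homotopic_refl | exact: path_homotopic_sym
       | exact: path_homotopic_trans].
Qed.

#[export] Instance path_concat_proper (x y z : X) :
  Proper (respectful (@path_homotopic R X x y)
    (respectful (@path_homotopic R X y z) (@path_homotopic R X x z)))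
    (@path_concat R X x y z).
Proof. by move=> a a' aa' b b' bb'; exact: path_homotopic_concat. Qed.

Variables (x y z : X).

Lemma concatpK (a : {path I from x to y}) (b : {path I from y to z}) :
  path_homotopic (path_concat (path_concat a b) (path_reverse b)) a.
Proof. by rewrite -concatA concatpV concatp1. Qed.

Lemma concatpVK (a : {path I from x to z}) (b : {path I from y to z}) :
  path_homotopic (path_concat (path_concat a (path_reverse b)) b) a.
Proof. by rewrite -concatA concatVp concatp1. Qed.

Lemma concatKp (a : {path I from x to y}) (b : {path I from y to z}) :
  path_homotopic (path_concat (path_reverse a) (path_concat a b)) b.
Proof. by rewrite concatA concatVp concat1p. Qed.

End homotopy_algebra.

(** * Paths from the base point modulo a subgroup *)

Section coset_relation.
Variables (R : realType) (X : topologicalType) (x0 : X) (H : set (pi1 R x0)).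
Hypothesis Hgrp : is_subgroup H.
Local Notation I := (unit_interval R).

Lemma subgroup1 : H 1%g.
Proof. by have [/set_mem] := Hgrp. Qed.

Lemma subgroupV c : H c -> H c^-1%g.
Proof.
move=> Hc; have [H1 Hdiv] := Hgrp; rewrite -[c^-1%g]mul1g.
by apply: set_mem; apply: Hdiv => //; exact: mem_set.
Qed.

Lemma subgroupM c d : H c -> H d -> H (c * d)%g.
Proof.
move=> Hc Hd; have [_ Hdiv] := Hgrp; rewrite -[d]invgK.
by apply: set_mem; apply: Hdiv; apply: mem_set => //; exact: subgroupV.
Qed.

(** Equality modulo H is equality of right cosets. With the loop h on the left
    of b, each closure property of the relation comes from one of H. *)
Lemma path_eq_modP (x : X) (a b : {path I from x0 to x}) :
  path_eq_mod H a b <->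
  exists2 h : {path I from x0 to x0},
    H (pi1_class h) & path_homotopic a (path_concat h b).
Proof.
split=> [Hab|[h Hh ahb]].
  by exists (path_concat a (path_reverse b)) => //; rewrite concatpVK.
rewrite /path_eq_mod (_ : pi1_class _ = pi1_class h)//.
by apply/pi1_classP; rewrite ahb concatpK.
Qed.

#[export] Instance path_eq_mod_proper (x : X) :
  Proper (respectful (@path_homotopic R X x0 x)
    (respectful (@path_homotopic R X x0 x) iff)) (@path_eq_mod R X x0 H x).
Proof.
move=> a a' aa' b b' bb'; rewrite /path_eq_mod.
suff -> : pi1_class (path_concat a (path_reverse b)) =
          pi1_class (path_concat a' (path_reverse b')) by [].
by apply/pi1_classP; rewrite aa' (path_homotopic_reverse bb').
Qed.

Lemma path_eq_mod_refl (x : X) (a : {path I from x0 to x}) : path_eq_mod H a a.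
Proof.
apply/path_eq_modP; exists (path_const R x0); last by rewrite concat1p.
by rewrite pi1_class1; exact: subgroup1.
Qed.

Lemma path_eq_mod_sym (x : X) (a b : {path I from x0 to x}) :
  path_eq_mod H a b -> path_eq_mod H b a.
Proof.
move=> /path_eq_modP[h Hh ahb]; apply/path_eq_modP; exists (path_reverse h).
  by rewrite pi1_classV; exact: subgroupV.
by rewrite ahb concatKp.
Qed.

Lemma path_eq_mod_trans (x : X) (a b c : {path I from x0 to x}) :
  path_eq_mod H a b -> path_eq_mod H b c -> path_eq_mod H a c.
Proof.
move=> /path_eq_modP[h Hh ahb] /path_eq_modP[k Hk bkc]; apply/path_eq_modP.
exists (path_concat h k); last by rewrite ahb bkc concatA.
by rewrite pi1_classM; exact: subgroupM.
Qed.

Lemma path_eq_mod_concat (x y : X) (a b : {path I from x0 to x})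
    (c : {path I from x to y}) :
  path_eq_mod H a b -> path_eq_mod H (path_concat a c) (path_concat b c).
Proof.
move=> /path_eq_modP[h Hh ahb]; apply/path_eq_modP; exists h => //.
by rewrite ahb concatA.
Qed.

Lemma path_eq_mod_loop (a b : {path I from x0 to x0}) :
  path_eq_mod H a b -> H (pi1_class b) -> H (pi1_class a).
Proof.
move=> /path_eq_modP[h Hh /pi1_classP ->] Hb.
by rewrite pi1_classM; exact: subgroupM.
Qed.

End coset_relation.

(** * Restricting a path to a subinterval *)

Section subpaths.
Variables (R : realType) (X : topologicalType).
Local Notation I := (unit_interval R).
Local Open Scope ring_scope.

(** The bounds s and t come in any order, a reversed interval giving a path that
    runs backwards, so that [subpath_concat] can be used to move in either
    direction along a path. The endpoints are given up to equality proofs so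
    that a subpath starting at time zero is a path from x, and not merely from
    a zero. *)
Section subpath.
Variables (x y : X) (a : {path I from x to y}) (s t : I).

Definition subpath_fun (u : I) : X :=
  a (uiproj (uival s + uival u * (uival t - uival s))).

Lemma subpath_continuous : continuous subpath_fun.
Proof.
apply: comp_uiproj_continuous; first exact: cts_fun.
apply: cont_add; first exact: cst_continuous.
by apply: cont_mul; [exact: uival_continuous | exact: cst_continuous].
Qed.

Variables (p q : X) (asp : a s = p) (atq : a t = q).

Lemma subpath_zero : subpath_fun zero = p.
Proof. by rewrite /subpath_fun uival_zero mul0r addr0 uivalK. Qed.

Lemma subpath_one : subpath_fun one = q.
Proof. by rewrite /subpath_fun uival_one mul1r addrC subrK uivalK. Qed.

Definition subpath : {path I from p to q} :=
  mk_path subpath_continuous subpath_zero subpath_one.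

End subpath.

Lemma subpath_concat (x y p q w : X) (a : {path I from x to y}) (r s t : I)
    (arp : a r = p) (asq : a s = q) (atw : a t = w) :
  path_homotopic (path_concat (subpath arp asq) (subpath asq atw))
                 (subpath arp atw).
Proof.
(* both sides precompose a with real functions that agree at the ends *)
pose u (z : I) : R :=
  if uival z <= 2^-1 then uival r + (2 * uival z) * (uival s - uival r)
  else uival s + (2 * uival z - 1) * (uival t - uival s).
pose v (z : I) : R := uival r + uival z * (uival t - uival r).
have c2 : continuous (fun z : I => 2 * uival z).
  by apply: cont_mul; [exact: cst_continuous | exact: uival_continuous].
apply: (@path_homotopic_reparam _ _ _ _ _ _ a _ _ u v).
- apply: continuous_paste.
  + exact: uival_continuous.
  + apply: cont_add; first exact: cst_continuous.
    by apply: cont_mul => //; exact: cst_continuous.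
  + apply: cont_add; first exact: cst_continuous.
    apply: cont_mul; last exact: cst_continuous.
    by apply: cont_sub => //; exact: cst_continuous.
  + by move=> z ->; lra.
- apply: cont_add; first exact: cst_continuous.
  by apply: cont_mul; [exact: uival_continuous | exact: cst_continuous].
- by rewrite /u /v uival_zero invr_ge0 ler0n; lra.
- by rewrite /u /v uival_one ifF; [lra | apply/negbTE; lra].
- move=> z; have := uival_ge0 z; have := uival_le1 z => z1 z0.
  rewrite /path_concat /= /concat_fun /u; case: ifPn => z2.
    by rewrite /= /mk_path /subpath_fun uiprojK//; lra.
  by rewrite /= /mk_path /subpath_fun uiprojK//; lra.
- by [].
Qed.

Lemma subpath_full (x y : X) (a : {path I from x to y}) :
  subpath (path_zero (s := a)) (path_one (s := a)) = a.
Proof.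
apply/path_eqP => u.
rewrite /= /mk_path /subpath_fun uival_zero uival_one.
by rewrite add0r subr0 mulr1 uivalK.
Qed.

Lemma subpath_trivial (x y p : X) (a : {path I from x to y}) (s : I)
    (asp : a s = p) :
  subpath asp asp = path_const R p.
Proof.
apply/path_eqP => u.
by rewrite /= /mk_path /subpath_fun subrr mulr0 addr0 uivalK asp.
Qed.

Definition ui_segment (l r : R) : set I := [set u | l <= uival u <= r].

Lemma range_subpath (x y p q : X) (a : {path I from x to y}) (s t : I)
    (asp : a s = p) (atq : a t = q) (l r : R) (V : set X) :
  ui_segment l r s -> ui_segment l r t -> a @` ui_segment l r `<=` V ->
  range (subpath asp atq) `<=` V.
Proof.
rewrite /ui_segment /= => /andP[ls sr] /andP[lt tr] aV _ [u _ <-].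
apply: aV; rewrite /= /mk_path /subpath_fun.
set z := (_ + _); exists (uiproj z) => //=.
have := uival_ge0 u; have := uival_le1 u => u1 u0.
have := uival_ge0 s; have := uival_le1 s => s1 s0.
have := uival_ge0 t; have := uival_le1 t => t1 t0.
by rewrite /z uiprojK; apply/andP; split; nra.
Qed.

(** The retraction carries compactness and connectedness from the segment of the
    line to the unit interval. *)
Lemma uiproj_segment : @uiproj R @` `[0, 1]%classic = [set: I].
Proof.
rewrite -subTset => u _; exists (uival u); rewrite ?uivalK//=.
by rewrite in_itv/= uival_ge0 uival_le1.
Qed.

Lemma ui_compact : compact [set: I].
Proof.
rewrite -uiproj_segment; apply: continuous_compact; last exact: segment_compact.
by apply: continuous_subspaceT => z; exact: uiproj_continuous.
Qed.

Lemma ui_connected : connected [set: I].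
Proof.
rewrite -uiproj_segment.
apply: connected_continuous_connected; first exact: segment_connected.
by apply: continuous_subspaceT => z; exact: uiproj_continuous.
Qed.

Lemma ui_segment_compact (l r : R) : compact (ui_segment l r).
Proof.
apply: (@subclosed_compact _ _ setT) => //; last exact: ui_compact.
rewrite (_ : ui_segment l r = @uival R @^-1` `[l, r]%classic).
  apply: preimage_closed; last exact: itv_closed.
  by move=> u _; exact: uival_continuous.
by apply/seteqP; split=> u /=; rewrite in_itv.
Qed.

Lemma ui_segment_nbhs (f : I -> X) (s : I) (V : set X) :
  continuous f -> nbhs (f s) V ->
  exists l r : R, nbhs s (ui_segment l r) /\ f @` ui_segment l r `<=` V.
Proof.
move=> cf fsV.
have cg : continuous (fun z : R => f (uiproj z)).
  by apply: (comp_uiproj_continuous cf (u := id)) => z.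
have : nbhs (uival s) ((fun z => f (uiproj z)) @^-1` V).
  by apply: cg; rewrite uivalK.
move=> /nbhs_ballP[e /= e0 seV].
exists (uival s - e / 2), (uival s + e / 2); split.
  have : nbhs (uival s) (ball (uival s) (e / 2)).
    by apply: nbhsx_ballx; lra.
  move=> /(@uival_continuous R s); apply: (@filterS _ (nbhs s)) => u /=.
  by rewrite /ball/= ltr_norml /ui_segment /=; lra.
move=> _ [u + <-]; rewrite /ui_segment /= => lur.
rewrite -[u]uivalK; apply: seV.
by rewrite /ball/= ltr_norml; lra.
Qed.

End subpaths.

(** * Neighborhoods in the space of paths *)

Section path_space.
Variables (R : realType) (X : topologicalType).
Local Notation I := (unit_interval R).

Lemma near_path_image (x y : X) (a : {path I from x to y}) (K : set I)
    (V : set X) :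
  compact K -> open V -> a @` K `<=` V ->
  nbhs a [set a' : {path I from x to y} | a' @` K `<=` V].
Proof.
move=> Kc Vo aKV; apply: open_nbhs_nbhs; split=> //.
exists [set g : {compact-open, I -> X} | g @` K `<=` V] => //.
exact: compact_open_open.
Qed.

(** The sets of functions containing every map into some neighborhood of x form
    a filter. It converges to the constant map in the compact-open topology,
    since one tests convergence on a single pair (K, O) at a time, and O itself
    is then such a neighborhood unless K is empty. *)
Lemma nbhs_path_const (x : X) (N : set {path I from x to x}) :
  nbhs (path_const R x) N ->
  exists W : set X, [/\ open W, W x &
    forall b : {path I from x to x}, range b `<=` W -> N b].
Proof.
rewrite nbhsE => -[_ [[B Bo <-] Bx] BN].
pose F : set_system {compact-open, I -> X} :=
  [set A | exists W : set X, [/\ open W, W x &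
     forall g : I -> X, range g `<=` W -> A g]].
have FF : Filter F.
  split=> [|A A' [W [Wo Wx WA]] [W' [Wo' Wx' WA']]|A A' AA' [W [Wo Wx WA]]].
  - by exists setT; split=> //; exact: openT.
  - exists (W `&` W'); split=> //; first exact: openI.
    by move=> g gW; split; [apply: WA|apply: WA'] => u /gW[].
  - by exists W; split=> // g /WA /AA'.
have Fx : F --> (cst x : {compact-open, I -> X}).
  apply/compact_open_cvgP => K O _ Oo KO.
  have [->|/set0P[u Ku]] := eqVneq K set0.
    exists setT; split=> //; first exact: openT.
    by move=> g _; rewrite /= image_set0.
  exists O; split=> //; first by apply: KO; exists u.
  by move=> g gO _ [v _ <-]; apply: gO; exists v.
have [W [Wo Wx WB]] : F B by apply: Fx; exact: open_nbhs_nbhs.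
by exists W; split=> // b bW; apply: BN; exact: WB.
Qed.

End path_space.

(** * Open subgroups of the fundamental group *)

Section open_subgroups.
Variables (R : realType) (X : topologicalType) (x0 : X) (H : set (pi1 R x0)).
Hypothesis Hgrp : is_subgroup H.
Local Notation I := (unit_interval R).
Local Notation loop := {path I from x0 to x0}.

(** Openness at 1 propagates to all of H by translation. *)
Lemma open_whP :
  open (H : set (pi1_wh R x0)) <->
  exists W : set X, [/\ open W, W x0 &
    forall b : loop, range b `<=` W -> H (pi1_class b)].
Proof.
split=> [[D Dopen HE]|[W [Wo Wx WH]]].
  have DH c : (exists2 i, D i & whisker_set i.1 i.2 c) = H c.
    exact: (congr1 (@^~ c) HE).
  have [[c W] Di [a aW ca1]] : exists2 i, D i & whisker_set i.1 i.2 1%g.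
    by rewrite DH; exact: subgroup1.
  have [/= Wo Wx] := Dopen _ Di.
  exists W; split=> // b bW; rewrite -DH; exists (c, W) => //.
  exists (path_concat a b); first exact: range_concat.
  by rewrite pi1_classM mulgA ca1 mul1g.
exists [set i : pi1 R x0 * set X | H i.1 /\ i.2 = W].
  by move=> [c V] [/= _ ->].
apply/seteqP; split=> [d [[c V] /= [Hc ->] [b bW <-]]|c Hc].
  by apply: subgroupM => //; exact: WH.
exists (c, W) => //; exists (path_const R x0); first by move=> _ [t _ <-].
by rewrite pi1_class1 mulg1.
Qed.

Lemma open_qtopP :
  open (H : set (pi1_qtop R x0)) <->
  forall a : loop, H (pi1_class a) -> \forall a' \near a, H (pi1_class a').
Proof.
by rewrite {1}/open /= /quotient_open openE.
Qed.

Lemma open_qtop_wh :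
  open (H : set (pi1_qtop R x0)) -> open (H : set (pi1_wh R x0)).
Proof.
move=> /open_qtopP Hq; apply/open_whP; apply: nbhs_path_const.
by apply: Hq; rewrite pi1_class1; exact: subgroup1.
Qed.

(** The absence of holonomy modulo H in V, seen from the base point through a:
    with e constant, it says that the loops in V, conjugated by a, lie in H. *)
Definition paths_agree_after (x : X) (a : {path I from x0 to x}) (V : set X) :=
  forall (y : X) (d e : {path I from x to y}),
    range d `<=` V -> range e `<=` V ->
    path_eq_mod H (path_concat a d) (path_concat a e).

Lemma range_reverse (x y : X) (a : {path I from x to y}) (V : set X) :
  range a `<=` V -> range (path_reverse a) `<=` V.
Proof. by move=> aV _ [t _ <-]; apply: aV; eexists. Qed.

(** By small loop transfer along a, the loop made of d followed by the reverse
    of e is equivalent modulo H, once conjugated by a, to a loop in a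
    neighborhood U of the base point; the loops in U all have their class in
    H. *)
Lemma SLT_paths_agree :
  SLT_at H -> open (H : set (pi1_wh R x0)) ->
  forall (x : X) (a : {path I from x0 to x}),
    exists V, [/\ open V, V x & paths_agree_after a V].
Proof.
move=> slt /open_whP[U [Uo Ux UH]] x a.
have [V [Vo Vx aVU]] := slt x a U Uo Ux.
exists V; split=> // y d e dV eV.
have [|c cU acH] := aVU (path_concat d (path_reverse e)).
  by apply: range_concat => //; exact: range_reverse.
apply/path_eq_modP => //; eexists; first exact: path_eq_mod_loop acH (UH _ cU).
rewrite (concatA _ a e) concatpVK -(concatA a) concatpVK.
exact: path_homotopic_refl.
Qed.

Hypothesis lpc : locally_path_connected R X.
Hypothesis agree : forall (x : X) (a : {path I from x0 to x}),
    exists V, [/\ open V, V x & paths_agree_after a V].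

(** The neighborhood of a in which a' ranges may depend on W, so that c can be
    required to be as short as desired. The endpoints p and q stand for a t and
    a' t, which are only propositionally x0 at the two ends of the interval. *)
Definition tracked (a : loop) (t : I) : Prop :=
  forall W : set X, open W -> W (a t) ->
  nbhs a [set a' : loop | forall (p q : X) (atp : a t = p) (atq : a' t = q),
    exists2 c : {path I from p to q}, range c `<=` W &
      path_eq_mod H (path_concat (subpath path_zero atp) c)
                    (subpath path_zero atq)].

Lemma tracked_zero (a : loop) : tracked a zero.
Proof.
move=> W Wo Wa; near=> a' => p q ap aq.
have px : x0 = p by rewrite -ap path_zero.
have qx : x0 = q by rewrite -aq path_zero.
case: p / px ap => ap; case: q / qx aq => aq; rewrite path_zero in Wa.
exists (path_const R x0); first by move=> _ [t _ <-].
rewrite (Prop_irrelevance ap path_zero) (Prop_irrelevance aq path_zero).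
by rewrite !subpath_trivial concatp1; exact: path_eq_mod_refl.
Unshelve. all: by end_near. Qed.

(** Around s, choose V where paths agree after a restricted to [0, s], and an
    interval that a maps into V. For t and t' in it, going along a from a s to
    a t', then by d to a' t', or along a from a s to a t, then by c to a' t and
    along a' to a' t', are two ways of staying in V. *)
Lemma tracked_locally_stable (a : loop) (s : I) :
  exists2 K : set I, nbhs s K &
    forall t t', K t -> K t' -> tracked a t -> tracked a t'.
Proof.
have [V [Vo Vs sV]] := agree (subpath (path_zero (s := a)) (erefl (a s))).
have [|l [r [sK aKV]]] := @ui_segment_nbhs R X a s V (@cts_fun _ _ a).
  exact: open_nbhs_nbhs.
have Ks := nbhs_singleton sK.
exists (ui_segment l r) => // t t' Kt Kt' at_tracked W Wo Wat'.
have [|W' [Wo' Wat W'WV W'conn]] := lpc (x := a t') (U := W `&` V).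
  by apply: open_nbhs_nbhs; split; [exact: openI|split=> //; exact/aKV/imageP].
have Vat : V (a t) by exact/aKV/imageP.
near=> a' => p q; case: p / => aq.
have a'KV : (a' : I -> X) @` ui_segment l r `<=` V.
  by near: a'; apply: near_path_image => //; exact: ui_segment_compact.
have [c cV ac] : exists2 c : {path I from a t to a' t}, range c `<=` V &
    path_eq_mod H (path_concat (subpath path_zero erefl) c)
                  (subpath path_zero erefl).
  by apply: (near (at_tracked V Vo Vat) a').
have W'q : W' q.
  rewrite -aq; suff : (a' : I -> X) @` [set t'] `<=` W' by apply; exists t'.
  near: a'; apply: near_path_image => //; first exact: compact_set1.
  by move=> _ [_ -> <-].
have [d dW'] := W'conn _ _ Wat W'q.
exists d; first by move=> z /dW' /W'WV[].
pose a_st := subpath (erefl (a s)) (erefl (a t)).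
pose a_st' := subpath (erefl (a s)) (erefl (a t')).
pose a'_tt' := subpath (erefl (a' t)) aq.
have detour : path_eq_mod H
    (path_concat (subpath path_zero (erefl (a s))) (path_concat a_st' d))
    (path_concat (subpath path_zero (erefl (a s)))
       (path_concat a_st (path_concat c a'_tt'))).
  apply: sV.
    apply: range_concat; first exact: range_subpath (aKV).
    by move=> z /dW' /W'WV[].
  apply: range_concat; first exact: range_subpath (aKV).
  by apply: range_concat => //; exact: range_subpath (a'KV).
have follow := path_eq_mod_concat a'_tt' ac.
rewrite -(subpath_concat _ (erefl (a s))) -concatA.
apply: path_eq_mod_trans detour _ => //.
by rewrite subpath_concat in follow; rewrite concatA subpath_concat concatA.
Unshelve. all: by end_near. Qed.

Lemma open_wh_qtop : open (H : set (pi1_wh R x0)) ->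
  open (H : set (pi1_qtop R x0)).
Proof.
move=> /open_whP[U [Uo Ux UH]]; apply/open_qtopP => a Ha.
have a1 : tracked a one.
  apply: (connected_locally_stable (@ui_connected R)).
    by exists zero; exact: tracked_zero.
  exact: tracked_locally_stable.
have Ua : U (a one) by rewrite path_one.
apply: filterS (a1 U Uo Ua) => a'.
move=> /(_ _ _ path_one path_one)[c cU]; rewrite !subpath_full => aca'.
apply: (path_eq_mod_loop Hgrp (path_eq_mod_sym Hgrp aca')).
by rewrite pi1_classM; apply: subgroupM => //; exact: UH.
Qed.

End open_subgroups.

Theorem proposition3p5 (R : realType) (X : topologicalType) (x0 : X)
    (H : set (pi1 R x0)) :
  path_connected R [set: X] ->
  locally_path_connected R X ->
  is_subgroup H ->
  SLT_at H ->
  (open_subgroup_wh H <-> open_subgroup_qtop H).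
Proof.
move=> _ lpc Hgrp slt; split=> -[_ Ho]; split=> //.
  exact: open_wh_qtop (SLT_paths_agree Hgrp slt Ho) Ho.
exact: open_qtop_wh.
Qed.
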